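(* There exist a complex Hilbert space and a densely defined closed operator $T$ on it such that $TT^*-T^*T$ is bounded, whereas $|T||T^*|-|T^*||T|$ is unbounded.
   Context: Operators are linear maps $T$ defined on a linear subspace $D(T)$ of a Hilbert space $\mathcal H$ with values in $\mathcal H$; $T$ is closed if its graph is closed in $\mathcal H\oplus\mathcal H$. An operator $T$ is called bounded if there is a constant $M\ge 0$ with $\|Tx\|\le M\|x\|$ for all $x\in D(T)$ (boundedness is on its own domain, which need not be dense and may even be $\{0\}$), and unbounded otherwise. $T^*$ denotes the adjoint of a densely defined operator $T$. Products and differences have their natural domains $D(RS)=\{x\in D(S): Sx\in D(R)\}$ and $D(R-S)=D(R)\cap D(S)$. For a densely defined closed operator $T$, $|T|=(T^*T)^{1/2}$ and $|T^*|=(TT^* )^{1/2}$ are the unique positive self-adjoint square roots of the positive self-adjoint operators $T^*T$ and $TT^*$. *)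

(* Defs.v *)
From HB Require Import structures.
From mathcomp Require Import all_boot all_order all_algebra.
From mathcomp Require Import sesquilinear complex.
From mathcomp Require Import all_classical all_reals all_analysis.

Set Implicit Arguments.
Unset Strict Implicit.
Unset Printing Implicit Defensive.

Import Order.TTheory GRing.Theory Num.Theory.
Import numFieldNormedType.Exports.

Local Open Scope classical_set_scope.
Local Open Scope ring_scope.
Local Open Scope complex_scope.

(* The inner product is linear in its first argument and conjugate-linear in
   its second one; [inner_norm] makes the norm (which takes its values in the
   nonnegative reals of R[i]) the Hilbert norm. *)
Record hilbertSpace (R : realType) := HilbertSpace {
  hilbert_carrier :> completeNormedModType R[i];
  inner : {dot hilbert_carrier for Num.conj};
  inner_norm : forall x : hilbert_carrier, inner x x = `|x| ^+ 2
}.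

(* The values of a partial map outside its domain are irrelevant: every notion
   below only depends on the values on the domain. *)
Record partialMap (H : Type) := PartialMap {
  dom : set H;
  pfun :> H -> H
}.

Section Operators.
Variables (R : realType) (H : hilbertSpace R).
Implicit Types S T A : partialMap H.

Definition is_operator T : Prop :=
  [/\ dom T 0,
      forall (a : R[i]) (x y : H), dom T x -> dom T y -> dom T (a *: x + y) &
      forall (a : R[i]) (x y : H), dom T x -> dom T y ->
        T (a *: x + y) = a *: T x + T y].

Definition op_eq S T : Prop :=
  dom S = dom T /\ forall x, dom S x -> S x = T x.

Definition densely_defined T : Prop := dense (dom T).

Definition graph T : set (H * H) := [set p | dom T p.1 /\ p.2 = T p.1].

Definition closed_op T : Prop := closed (graph T).

Definition bounded_op T : Prop :=
  exists2 M : R, 0 <= M & forall x : H, dom T x -> `|T x| <= M%:C * `|x|.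

Definition comp_op S T : partialMap H :=
  PartialMap [set x | dom T x /\ dom S (T x)] (fun x => S (T x)).

Definition sub_op S T : partialMap H :=
  PartialMap (dom S `&` dom T) (fun x => S x - T x).

Definition adjoint_spec T (y z : H) : Prop :=
  forall x : H, dom T x -> inner H (T x) y = inner H x z.

(* Meaningful only for a densely defined [T], in which case the vector [z]
   representing the functional x |-> <T x, y> is unique. *)
Definition adjoint T : partialMap H :=
  PartialMap [set y | exists z, adjoint_spec T y z]
             (fun y => xget 0 [set z | adjoint_spec T y z]).

Definition self_adjoint A : Prop :=
  [/\ is_operator A, densely_defined A & op_eq (adjoint A) A].

(* In R[i], 0 <= z means that z is real and nonnegative. *)
Definition positive_op A : Prop :=
  forall x : H, dom A x -> 0 <= inner H (A x) x.

(* [A] is the positive self-adjoint square root of [S]; the equality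
   A^2 = S includes the equality of the domains. *)
Definition is_positive_sqrt S A : Prop :=
  [/\ self_adjoint A, positive_op A & op_eq (comp_op A A) S].

(* [A] is |T|, the positive square root of T^* T. *)
Definition is_modulus T A : Prop := is_positive_sqrt (comp_op (adjoint T) T) A.

(* [A] is |T^*|, the positive square root of T T^*. *)
Definition is_adjoint_modulus T A : Prop :=
  is_positive_sqrt (comp_op T (adjoint T)) A.

End Operators.

(* Main.v *)
Require Import Defs.
From HB Require Import structures.
From mathcomp Require Import all_boot all_order all_algebra.
From mathcomp Require Import sesquilinear complex ring lra zify.
From mathcomp Require Import all_classical all_reals all_analysis.

(** The mechanism is that |T||T*| - |T*||T| and TT* - T*T are the commutator
    and the difference of squares of two positive operators, and that these
    are governed by opposite signs.  Write |T| = S + D and |T*| = S - D, with S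
    unbounded and D bounded.  Then, where everything is defined,

      |T|^2 - |T*|^2 = 2 (SD + DS)     and     [|T|, |T*|] = 2 (DS - SD).

    If SD + DS vanishes on the common natural domain, the first operator is
    zero there, while the second one is 4 DS.

    On l^2(N) take S = diag(s_i) with s_i = 16^i, and let D be the matrix with
    entries w_i w_j / (s_i + s_j), w_i = 2^i, for i and j of opposite parity,
    and 0 otherwise.  The entries are at most 2^-(i+j) / 2 in absolute value, so
    D is a contraction, while S >= 1; hence S + D and S - D are positive and
    self-adjoint.  The denominators make SD + DS formally the
    matrix w_i w_j restricted to opposite parities:

      (SDx + DSx)_i = w_i * sum over j of parity opposite to i of w_j x_j.

    The two sums on the right do not depend on i beyond its parity, and the
    w_i are unbounded: if SDx + DSx is to be in l^2, both sums must be zero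
    (anticommutator_eq0).  So the natural domains force SD + DS = 0 on them.
    But DS stays unbounded there: the vectors e_0 - e_n / w_n with n even are
    of norm at most 2, satisfy both linear constraints, and the coordinate of
    index n + 1 of their image under DS is of size 2 * 2^n / 17.

    It remains to find T.  The parity condition on D says that the unitary
    involution J = diag((-1)^i) commutes with S and anticommutes with D, so
    J (S + D) J = S - D.  For any positive self-adjoint A and symmetric
    involution J, the operator T = JA is closed, T* = AJ, |T| = A and
    |T*| = JAJ (left_twist_modulus, left_twist_adjoint_modulus); T = J (S + D)
    is the required operator.

    The space l^2(N) over R[i] is built here: the inner product from a pair of
    real series, the norm from the inner product, and completeness
    coordinatewise. *)

Set Implicit Arguments.
Unset Strict Implicit.
Unset Printing Implicit Defensive.

Import Order.TTheory GRing.Theory Num.Theory.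
Import numFieldNormedType.Exports.

Local Open Scope classical_set_scope.
Local Open Scope ring_scope.
Local Open Scope complex_scope.

Local Notation re := (@complex.Re _).
Local Notation im := (@complex.Im _).

(** * The norm of an inner product *)
Section DotNorm.
Variables (C : numClosedFieldType) (U : lmodType C) (form : {dot U for Num.conj}).

Lemma dot_Zl a (u v : U) : form (a *: u) v = a * form u v.
Proof. exact: linearZl_LR. Qed.

Lemma dot_Zr a (u v : U) : form u (a *: v) = a^*%R * form u v.
Proof. exact: linearZr_LR. Qed.

(** Expand the square of <v,v> u - <u,v> v, scaled so as to avoid a division; the
    factor <v,v> that comes out is positive. *)
Lemma dot_CauchySchwarz (u v : U) :
  `|form u v| ^+ 2 <= form u u * form v v.
Proof.
have [->|v0] := eqVneq v 0.
  by rewrite !linear0r normr0 expr0n /=.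
have vv0 : 0 < form v v by rewrite dnorm_gt0.
have : 0 <= form (form v v *: u - form u v *: v) (form v v *: u - form u v *: v).
  exact: dnorm_ge0.
rewrite dnormB !dnormZ !dot_Zl !dot_Zr !rmorphM /= conjCK.
rewrite (ger0_norm (ltW vv0)) normCK (CrealP (gtr0_real vv0)).
set a := form v v; set b := form u v; set c := form u u.
rewrite (_ : _ - _ = a * (c * a - b * b^*%R)); last by ring.
by rewrite pmulr_rge0 // subr_ge0.
Qed.

Definition dot_norm (u : U) : C := sqrtC (form u u).

Lemma dot_norm_ge0 u : 0 <= dot_norm u.
Proof. by rewrite sqrtC_ge0 dnorm_ge0. Qed.

Lemma dot_normrZ a u : dot_norm (a *: u) = `|a| * dot_norm u.
Proof.
by rewrite /dot_norm dnormZ rootCMl ?exprn_ge0 // sqrCK.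
Qed.

Lemma dot_normr0_eq0 u : dot_norm u = 0 -> u = 0.
Proof. by move/eqP; rewrite sqrtC_eq0 dnorm_eq0 => /eqP. Qed.

Lemma dot_normD u v : dot_norm (u + v) <= dot_norm u + dot_norm v.
Proof.
rewrite -(@ler_sqr C) ?nnegrE ?addr_ge0 ?dot_norm_ge0 //.
rewrite sqrrD !sqrtCK dnormD addrAC lerD2r lerD2l.
have b0 : 0 <= dot_norm u * dot_norm v by rewrite mulr_ge0 ?dot_norm_ge0.
rewrite (le_trans (y := `|form u v| *+ 2)) //.
  rewrite mulr2n -[X in _ <= _ + X]norm_conjC (le_trans _ (ler_normD _ _)) //.
  by rewrite real_ler_norm // CrealE rmorphD /= conjCK addrC.
rewrite lerMn2r /= -(@ler_sqr C) ?nnegrE //.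
by rewrite exprMn !sqrtCK dot_CauchySchwarz.
Qed.

End DotNorm.

(** * Series of real and complex numbers *)
Section RealSeries.
Variable R : realType.
Implicit Types a b : R^nat.

(** For nonnegative terms, this is convergence without mention of a limit, which
    makes closure under linear combinations an arithmetical matter. *)
Definition bounded_sums a := exists M : R, forall n, \sum_(i < n) a i <= M.

Lemma series_ord a n : series a n = \sum_(i < n) a i.
Proof. by rewrite /series /= big_mkord. Qed.

Lemma bounded_sums_cvg a : (forall i, 0 <= a i) -> bounded_sums a ->
  cvgn (series a).
Proof.
move=> a0 [M aM]; apply: nondecreasing_is_cvgn.
  by apply: nondecreasing_series => i _ _.
by exists M => _ [n _ <-]; rewrite series_ord.
Qed.

Lemma dominated_series_cvg a b : (forall i, `|a i| <= b i) ->
  bounded_sums b -> cvgn (series a).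
Proof.
move=> ab [M bM]; apply: normed_cvg; apply: bounded_sums_cvg => [i|].
  exact: normr_ge0.
exists M => n; apply: (le_trans _ (bM n)); apply: ler_sum => i _.
exact: ab.
Qed.

Lemma partial_sum_le_series a n : (forall i, 0 <= a i) -> cvgn (series a) ->
  \sum_(i < n) a i <= limn (series a).
Proof.
move=> a0 ca; rewrite -series_ord; apply: nondecreasing_cvgn_le => //.
by apply: nondecreasing_series => i _ _.
Qed.

Lemma series_le_bound a M : cvgn (series a) ->
  (forall n, \sum_(i < n) a i <= M) -> limn (series a) <= M.
Proof.
by move=> ca aM; apply: limr_le => //; near=> n; rewrite series_ord.
Unshelve. all: by end_near. Qed.

Lemma series_single a j : (forall i, i != j -> a i = 0) ->
  series a @ \oo --> a j.
Proof.
move=> a0; apply: cvg_near_cst; exists j.+1 => // n /= jn.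
rewrite series_ord (bigD1 (Ordinal jn)) //= big1 ?addr0 // => i ij.
by rewrite a0.
Qed.

End RealSeries.

Section ComplexSeries.
Variable R : realType.
Local Notation C := R[i].
Implicit Types u v : nat -> C.

(** Complex sums are computed on real and imaginary parts, so that convergence
    only relies on the completeness of the real numbers. *)
Definition csummable u :=
  cvgn (series (fun i => re (u i))) /\ cvgn (series (fun i => im (u i))).

Definition csum u : C :=
  limn (series (fun i => re (u i))) +i* limn (series (fun i => im (u i))).

Lemma csummable_csumP u (s : C) :
  series (fun i => re (u i)) @ \oo --> re s ->
  series (fun i => im (u i)) @ \oo --> im s -> csummable u /\ csum u = s.
Proof.
move=> hr hi; split; first by split; apply: cvgP; eassumption.
by rewrite /csum (cvg_lim _ hr) // (cvg_lim _ hi) //; case: s {hr hi}.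
Qed.

Lemma csumP a u v : csummable u -> csummable v ->
  csummable (fun i => a * u i + v i) /\
  csum (fun i => a * u i + v i) = a * csum u + csum v.
Proof.
move=> [ru iu] [rv iv]; apply: csummable_csumP.
  rewrite (_ : (fun _ => _) = (re a *: (fun i => re (u i)) -
    im a *: (fun i => im (u i))) + (fun i => re (v i))); last first.
    by apply/funext => i; rewrite !fctE; case: (a) (u i) (v i) => [? ?] [? ?] [? ?].
  rewrite !seriesD seriesN !seriesZ /csum; case: (a) => p q /=.
  by apply: cvgD => //; apply: cvgB; apply: cvgZl_tmp.
rewrite (_ : (fun _ => _) = (re a *: (fun i => im (u i)) +
    im a *: (fun i => re (u i))) + (fun i => im (v i))); last first.
  by apply/funext => i; rewrite !fctE; case: (a) (u i) (v i) => [? ?] [? ?] [? ?].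
rewrite !seriesD !seriesZ /csum; case: (a) => p q /=.
by apply: cvgD => //; apply: cvgD; apply: cvgZl_tmp.
Qed.

Lemma csum_conj u : csummable u -> csum (fun i => conjc (u i)) = conjc (csum u).
Proof.
move=> [ru iu]; apply: (csummable_csumP _ _).2.
  rewrite (_ : (fun _ => _) = (fun i => re (u i))) //.
  by apply/funext => i; rewrite ?fctE; case: (u i).
rewrite (_ : (fun _ => _) = - (fun i => im (u i))); last first.
  by apply/funext => i; rewrite ?fctE; case: (u i).
by rewrite seriesN /csum /=; apply: cvgN.
Qed.

Lemma csum_real (a : R^nat) : csum (fun i => (a i)%:C) = (limn (series a))%:C.
Proof.
rewrite /csum /= (_ : limn (series (fun _ => 0)) = 0) //.
by apply: cvg_lim => //; apply: (@series_single _ (fun=> 0) 0%N).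
Qed.

Lemma csum_single u j : (forall i, i != j -> u i = 0) -> csum u = u j.
Proof.
by move=> u0; apply: (csummable_csumP _ _).2;
  [apply: (@series_single _ (fun i => re (u i)))
  |apply: (@series_single _ (fun i => im (u i)))] => i /u0 ->.
Qed.

End ComplexSeries.

Section SquareSummable.
Variable R : realType.
Local Notation C := R[i].

Definition sqmod (z : C) : R := re z ^+ 2 + im z ^+ 2.

Lemma sqmodE z : (sqmod z)%:C = `|z| ^+ 2.
Proof. exact: add_Re2_Im2. Qed.

Lemma sqmod_ge0 z : 0 <= sqmod z.
Proof. by rewrite addr_ge0 ?sqr_ge0. Qed.

Lemma sqmodM w z : sqmod (w * z) = sqmod w * sqmod z.
Proof. by case: w z => [p q] [r s]; rewrite /sqmod /=; ring. Qed.

Lemma sqmodD_le w z : sqmod (w + z) <= 2 * sqmod w + 2 * sqmod z.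
Proof.
case: w z => [p q] [r s]; rewrite /sqmod /= -subr_ge0.
rewrite (_ : _ - _ = (p - r) ^+ 2 + (q - s) ^+ 2); last by ring.
by rewrite addr_ge0 ?sqr_ge0.
Qed.

Lemma sqmod_eq0 z : sqmod z = 0 -> z = 0.
Proof.
move=> z0; apply/eqP; rewrite -normr_eq0 -sqrf_eq0 -sqmodE z0.
by [].
Qed.

Lemma Re_mulJ_le w z : `|re (w * conjc z)| <= sqmod w + sqmod z.
Proof.
case: w z => [p q] [r s]; rewrite /sqmod /= ler_norml.
have := (sqr_ge0 (p + r), sqr_ge0 (p - r), sqr_ge0 (q + s), sqr_ge0 (q - s)).
have := (sqr_ge0 p, sqr_ge0 q, sqr_ge0 r, sqr_ge0 s).
by move=> [[[? ?] ?] ?] [[[? ?] ?] ?]; apply/andP; split; nra.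
Qed.

Lemma Im_mulJ_le w z : `|im (w * conjc z)| <= sqmod w + sqmod z.
Proof.
case: w z => [p q] [r s]; rewrite /sqmod /= ler_norml.
have := (sqr_ge0 (p + s), sqr_ge0 (p - s), sqr_ge0 (q + r), sqr_ge0 (q - r)).
have := (sqr_ge0 p, sqr_ge0 q, sqr_ge0 r, sqr_ge0 s).
by move=> [[[? ?] ?] ?] [[[? ?] ?] ?]; apply/andP; split; nra.
Qed.

Definition square_summable (x : nat -> C) := bounded_sums (fun i => sqmod (x i)).

Lemma square_summable_comb (a : C) x y :
  square_summable x -> square_summable y -> square_summable (a *: x + y).
Proof.
move=> [M xM] [N yN]; exists (2 * (sqmod a * M) + 2 * N) => n.
rewrite (le_trans (ler_sum _ (fun i _ => sqmodD_le _ _))) // big_split /=.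
rewrite -!mulr_sumr lerD ?ler_pM2l //; last exact: yN.
under eq_bigr => i _ do rewrite sqmodM.
by rewrite -mulr_sumr ler_wpM2l ?sqmod_ge0 //; exact: xM.
Qed.

Lemma square_summable0 : square_summable 0.
Proof. by exists 0 => n; rewrite big1 // => i _; rewrite /sqmod /= expr0n addr0. Qed.

Lemma mulJ_csummable x y : square_summable x -> square_summable y ->
  csummable (fun i => x i * conjc (y i)).
Proof.
move=> [M xM] [N yN].
have xy : bounded_sums (fun i => sqmod (x i) + sqmod (y i)).
  by exists (M + N) => n; rewrite big_split lerD.
split; apply: dominated_series_cvg xy => i; [exact: Re_mulJ_le|exact: Im_mulJ_le].
Qed.

End SquareSummable.

(** * The inner product space of square-summable sequences *)
Section Ell2.
Variable R : realType.
Local Notation C := R[i].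

Record ell2 := Ell2 { coord :> nat -> C; coord_l2 : square_summable coord }.

Lemma ell2_ext (x y : ell2) : x =1 y -> x = y.
Proof.
case: x y => [x hx] [y hy] /funext /= xy; rewrite xy in hx *.
by rewrite (Prop_irrelevance hx hy).
Qed.

HB.instance Definition _ := gen_eqMixin ell2.
HB.instance Definition _ := gen_choiceMixin ell2.

(* All the vector space operations are instances of a x + y; this is the only
   one whose square-summability has to be checked. *)
Fact ell2_lin_subproof (a : C) (x y : ell2) :
  square_summable (fun i => a * x i + y i).
Proof. exact: square_summable_comb (coord_l2 x) (coord_l2 y). Qed.

Fact ell2_zero_subproof : square_summable (fun=> 0 : C).
Proof. exact: square_summable0. Qed.

Let zero := Ell2 ell2_zero_subproof.
Let lin a x y := Ell2 (ell2_lin_subproof a x y).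
Let add x y := lin 1 x y.
Let opp x := lin (- 1) x zero.
Let scale a x := lin a x zero.

Let addA : associative add.
Proof. by move=> x y z; apply: ell2_ext => i /=; rewrite !mul1r addrA. Qed.
Let addC : commutative add.
Proof. by move=> x y; apply: ell2_ext => i /=; rewrite !mul1r addrC. Qed.
Let add0 : left_id zero add.
Proof. by move=> x; apply: ell2_ext => i /=; rewrite mul1r add0r. Qed.
Let addN : left_inverse zero opp add.
Proof.
by move=> x; apply: ell2_ext => i /=; rewrite mul1r mulN1r addr0 addNr.
Qed.

HB.instance Definition _ := GRing.isZmodule.Build ell2 addA addC add0 addN.

Lemma coordD (x y : ell2) i : (x + y) i = x i + y i.
Proof. by rewrite /= mul1r. Qed.

Lemma coordN (x : ell2) i : (- x) i = - x i.
Proof. by rewrite /= mulN1r addr0. Qed.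

Lemma coord0 i : (0 : ell2) i = 0.
Proof. by []. Qed.

Lemma coordB (x y : ell2) i : (x - y) i = x i - y i.
Proof. by rewrite coordD coordN. Qed.

Let scaleA a b x : scale a (scale b x) = scale (a * b) x.
Proof. by apply: ell2_ext => i /=; rewrite !addr0 mulrA. Qed.
Let scale1 : left_id 1 scale.
Proof. by move=> x; apply: ell2_ext => i /=; rewrite addr0 mul1r. Qed.
Let scaleDr : right_distributive scale +%R.
Proof.
by move=> a x y; apply: ell2_ext => i; rewrite coordD /= !addr0 mul1r mulrDr.
Qed.
Let scaleDl x : {morph scale^~ x : a b / a + b}.
Proof.
by move=> a b; apply: ell2_ext => i; rewrite coordD /= !addr0 mulrDl.
Qed.

HB.instance Definition _ :=
  GRing.Zmodule_isLmodule.Build C ell2 scaleA scale1 scaleDr scaleDl.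

Lemma coordZ a (x : ell2) i : (a *: x) i = a * x i.
Proof. by rewrite /= addr0. Qed.

Implicit Types x y z : ell2.

Definition inner2 (x y : ell2) : C := csum (fun i => x i * conjc (y i)).

Lemma inner2_csummable x y : csummable (fun i => x i * conjc (y i)).
Proof. exact: mulJ_csummable (coord_l2 x) (coord_l2 y). Qed.

Lemma inner2C x y : inner2 x y = conjc (inner2 y x).
Proof.
rewrite -csum_conj; last exact: inner2_csummable.
by congr csum; apply/funext => i; rewrite rmorphM /= conjcK mulrC.
Qed.

Lemma inner2_linl a x y z : inner2 (a *: x + y) z = a * inner2 x z + inner2 y z.
Proof.
rewrite -(csumP a (inner2_csummable x z) (inner2_csummable y z)).2.
by congr csum; apply/funext => i; rewrite coordD coordZ mulrDl mulrA.
Qed.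

Lemma inner2_linr a x y z : inner2 z (a *: x + y) = conjc a * inner2 z x + inner2 z y.
Proof.
by rewrite inner2C inner2_linl rmorphD rmorphM (inner2C z x) (inner2C z y).
Qed.

Lemma inner20l z : inner2 0 z = 0.
Proof. by have := inner2_linl 1 0 0 z; rewrite scaler0 addr0 mul1r => /eqP;
  rewrite -subr_eq subrr eq_sym => /eqP. Qed.

Lemma inner20r z : inner2 z 0 = 0.
Proof. by rewrite inner2C inner20l conjc0. Qed.

Fact inner2_Bl z : zmod_morphism (inner2^~ z).
Proof. by move=> x y /=; rewrite addrC -scaleN1r inner2_linl mulN1r addrC. Qed.

Fact inner2_Br z : zmod_morphism (inner2 z).
Proof.
by move=> x y /=; rewrite addrC -scaleN1r inner2_linr rmorphN rmorph1 mulN1r addrC.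
Qed.

Fact inner2_Zl z : scalable_for *%R (inner2^~ z).
Proof. by move=> a x /=; rewrite -[a *: x]addr0 inner2_linl inner20l addr0. Qed.

Fact inner2_Zr z : scalable_for (Num.conj \; *%R) (inner2 z).
Proof. by move=> a x /=; rewrite -[a *: x]addr0 inner2_linr inner20r addr0. Qed.

HB.instance Definition _ := isBilinear.Build C ell2 ell2 C *%R
  (Num.conj \; *%R) inner2 inner2_Bl inner2_Br inner2_Zl inner2_Zr.

Fact inner2_hermitian x y : inner2 x y = (-1) ^+ false * (inner2 y x)^*%R.
Proof. by rewrite mul1r inner2C. Qed.

HB.instance Definition _ :=
  isHermitianSesquilinear.Build C ell2 false Num.conj inner2 inner2_hermitian.

Definition sum_sqmod (x : ell2) : R := limn (series (fun i => sqmod (x i))).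

Lemma sum_sqmodE x : inner2 x x = (sum_sqmod x)%:C.
Proof.
rewrite /inner2 -csum_real; congr csum; apply/funext => i.
by rewrite sqmodE sqr_normc.
Qed.

Lemma partial_sum_sqmod x n : \sum_(i < n) sqmod (x i) <= sum_sqmod x.
Proof.
apply: partial_sum_le_series => [i|]; first exact: sqmod_ge0.
by apply: bounded_sums_cvg => [i|]; [exact: sqmod_ge0|exact: coord_l2].
Qed.

Lemma sum_sqmod_le x M : (forall n, \sum_(i < n) sqmod (x i) <= M) ->
  sum_sqmod x <= M.
Proof.
move=> xM; apply: series_le_bound => //.
by apply: bounded_sums_cvg => [i|]; [exact: sqmod_ge0|exact: coord_l2].
Qed.

Lemma sqmod_coord_le_sum x i : sqmod (x i) <= sum_sqmod x.
Proof.
apply: le_trans (partial_sum_sqmod x i.+1).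
by rewrite big_ord_recr lerDr sumr_ge0 // => j _; exact: sqmod_ge0.
Qed.

Fact inner2_gt0 x : x != 0 -> 0 < inner2 x x.
Proof.
move=> x0; rewrite sum_sqmodE ltcR.
have ss0 : 0 <= sum_sqmod x by apply: le_trans (partial_sum_sqmod x 0); rewrite big_ord0.
rewrite lt_neqAle ss0 andbT; apply: contra x0 => /eqP s0.
apply/eqP/ell2_ext => i; rewrite coord0; apply: sqmod_eq0; apply/eqP.
by rewrite eq_le sqmod_ge0 andbT s0 sqmod_coord_le_sum.
Qed.

HB.instance Definition _ := isDotProduct.Build C ell2 inner2 inner2_gt0.

HB.instance Definition _ := Lmodule_isNormed.Build C ell2
  (dot_normD inner2) (dot_normrZ inner2) (@dot_normr0_eq0 _ _ inner2).
End Ell2.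

(** * Completeness *)
Section Ell2Complete.
Variable R : realType.
Local Notation C := R[i].
Local Notation H := (ell2 R).
Implicit Types x y : H.

Lemma ell2_normE x : inner2 x x = `|x| ^+ 2.
Proof. by rewrite [LHS](esym (sqrtCK _)). Qed.

(** Reduces every norm estimate to finite partial sums, which pass to
    coordinatewise limits. *)
Lemma ell2_norm_leP x (r : R) : 0 <= r ->
  `|x| <= r%:C <-> forall n, \sum_(i < n) sqmod (x i) <= r ^+ 2.
Proof.
move=> r0.
have -> : (`|x| <= r%:C) = (sum_sqmod x <= r ^+ 2).
  rewrite -(@ler_sqr C) ?nnegrE ?ler0c // -ell2_normE sum_sqmodE -rmorphXn.
  exact: lecR.
split=> [xr n|]; first exact: le_trans (partial_sum_sqmod x n) xr.
exact: sum_sqmod_le.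
Qed.

Lemma sqmod_coord_le x i (r : R) : 0 <= r -> `|x| <= r%:C -> sqmod (x i) <= r ^+ 2.
Proof.
move=> r0 /(ell2_norm_leP _ r0)/(_ i.+1); apply: le_trans.
by rewrite big_ord_recr lerDr sumr_ge0 // => j _; exact: sqmod_ge0.
Qed.

Lemma re_im_coord_le x i (r : R) : 0 <= r -> `|x| <= r%:C ->
  `|re (x i)| <= r /\ `|im (x i)| <= r.
Proof.
move=> r0 /(sqmod_coord_le i r0); case: (x i) => p q /=; rewrite /sqmod /= => pq.
by split; rewrite -(@ler_sqr R) ?nnegrE // real_normK ?num_real //;
  apply: le_trans pq; rewrite ?lerDl ?lerDr sqr_ge0.
Qed.

Lemma real_gt0_complex (e : C) : 0 < e -> exists2 r : R, 0 < r & e = r%:C.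
Proof.
case: e => r s; rewrite ltcE /= => /andP[/eqP -> r0]; by exists r.
Qed.

Section Limit.
Variables (F : set_system H) (FF : ProperFilter F) (cF : cauchy F).

Lemma cauchy_near (r : R) : 0 < r ->
  \forall x \near F, \forall y \near F, `|x - y| <= r%:C.
Proof.
move=> r0; apply: nearP_dep; have /cauchy_ballP/(_ r%:C) := cF.
rewrite ltcR => /(_ r0); apply: filterS => -[x y] /=.
by rewrite -ball_normE /= => /ltW.
Qed.

(** Here f is the real or the imaginary part: each coordinate is a Cauchy family
    of real numbers, as it is dominated by the norm. *)
Lemma cauchy_coord_cvg (f : C -> R) i : {morph f : z w / z - w} ->
  (forall x (r : R), 0 <= r -> `|x| <= r%:C -> `|f (x i)| <= r) ->
  cvg ((fun x : H => f (x i)) @ F).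
Proof.
move=> fB fle; apply: cauchy_cvg; apply: cauchy_exP => e e0.
have e20 : 0 < e / 2 by rewrite divr_gt0.
have /filter_ex[x xF] := cauchy_near e20.
exists (f (x i)).
suff : \forall y \near F, ball (f (x i)) e (f ((y : H) i)) by [].
near=> y; rewrite -ball_normE /= -fB -coordB.
apply: (le_lt_trans (fle _ _ (ltW e20) _)); first by near: y.
by rewrite ltr_pdivrMr // ltr_pMr // ltr1n.
Unshelve. all: by end_near. Qed.

Definition lim_coord i : C :=
  lim ((fun x : H => re (x i)) @ F) +i* lim ((fun x : H => im (x i)) @ F).

Lemma re_coord_cvg i : (fun x : H => re (x i)) @ F --> re (lim_coord i).
Proof.
apply: cauchy_coord_cvg => [[? ?] [? ?] //|x r r0 xr].
by have [] := re_im_coord_le i r0 xr.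
Qed.

Lemma im_coord_cvg i : (fun x : H => im (x i)) @ F --> im (lim_coord i).
Proof.
apply: cauchy_coord_cvg => [[? ?] [? ?] //|x r r0 xr].
by have [] := re_im_coord_le i r0 xr.
Qed.

(** For x far enough along F, the partial sums of |x - y|^2 are at most r^2 for
    all y far enough along F; let y tend to its coordinatewise limit. *)
Lemma near_lim_coord (r : R) : 0 < r ->
  \forall x \near F,
    forall n, \sum_(i < n) sqmod ((x : H) i - lim_coord i) <= r ^+ 2.
Proof.
move=> r0; have := cauchy_near r0; apply: filterS => x xF n.
have cv : (fun y : H => \sum_(i < n) sqmod (x i - y i)) @ F -->
    \sum_(i < n) sqmod (x i - lim_coord i).
  apply: cvg_big => [|i _]; first exact: add_continuous.
  rewrite (_ : (fun _ => _) = fun y : H =>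
    (re (x i) - re (y i)) ^+ 2 + (im (x i) - im (y i)) ^+ 2); last first.
    by apply/funext => y; case: (x i) (y i) => [? ?] [? ?].
  rewrite (_ : sqmod _ = (re (x i) - re (lim_coord i)) ^+ 2 +
    (im (x i) - im (lim_coord i)) ^+ 2); last by case: (x i).
  apply: cvgD; apply: cvgM; apply: cvgB;
    by [exact: cvg_cst|exact: re_coord_cvg|exact: im_coord_cvg].
rewrite -(cvg_lim _ cv) //; apply: limr_le; first exact: cvgP cv.
apply: filterS xF => y /(ell2_norm_leP _ (ltW r0))/(_ n); apply: le_trans.
by apply: ler_sum => i _; rewrite coordB.
Qed.

(** The coordinatewise limit is square-summable because it differs from some
    element of the space by a square-summable sequence. *)
Lemma ell2_cauchy_cvg : cvg F.
Proof.
have [x xF] := filter_ex (near_lim_coord ltr01).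
have lx : square_summable (fun i => x i - lim_coord i) by exists (1 ^+ 2).
pose l := x - Ell2 lx.
have lE i : l i = lim_coord i by rewrite coordB subKr.
apply/cvg_ex; exists l; apply/cvgrPdist_le => /= _/real_gt0_complex[r r0 ->].
have := near_lim_coord r0; apply: filterS => y yF.
rewrite distrC; apply/ell2_norm_leP; first exact: ltW.
by move=> n; under eq_bigr => i _ do rewrite coordB lE.
Qed.

End Limit.

HB.instance Definition _ := Uniform_isComplete.Build H ell2_cauchy_cvg.

Definition ell2_hilbert : hilbertSpace R := @HilbertSpace R H (@inner2 R) ell2_normE.

End Ell2Complete.

(** * Self-adjoint operators twisted by an involution *)
Section AbstractOperators.
Variables (R : realType) (H : hilbertSpace R).
Implicit Types (S T A : partialMap H) (x y z : H).
Local Notation C := R[i].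

Lemma innerDl x y z : inner H (x + y) z = inner H x z + inner H y z.
Proof. exact: linearDl. Qed.

Lemma innerBl x y z : inner H (x - y) z = inner H x z - inner H y z.
Proof. exact: linearBl. Qed.

Lemma innerBr x y z : inner H z (x - y) = inner H z x - inner H z y.
Proof. exact: (linearB (inner H z)). Qed.

Lemma inner_conj x y : inner H x y = (inner H y x)^*%R.
Proof. by rewrite hermC /= expr0 mul1r. Qed.

Lemma inner_le x y : `|inner H x y| <= `|x| * `|y|.
Proof.
rewrite -(@ler_sqr C) ?nnegrE ?mulr_ge0 // exprMn -!inner_norm.
exact: dot_CauchySchwarz.
Qed.

(** A point x of the dense set closer to z than |z| would give
    |z|^2 = <z - x, z> <= |z - x| |z| < |z|^2. *)
Lemma dense_orthogonal (D : set H) z : dense D ->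
  (forall x, D x -> inner H x z = 0) -> z = 0.
Proof.
move=> dD Dz; apply/eqP/negPn/negP => z0.
have nz : 0 < `|z| by rewrite normr_gt0.
have [x [zx Dx]] : (ball z `|z| `&` D) !=set0.
  by apply: dD; [exists z; exact: ballxx|exact: ball_open].
have : `|z| ^+ 2 <= `|z - x| * `|z|.
  rewrite -inner_norm -[X in X <= _]ger0_norm ?dnorm_ge0 //.
  by rewrite -[inner H z z]subr0 -(Dz _ Dx) -innerBl inner_le.
move: zx; rewrite -ball_normE /= expr2 ler_pM2r // => /lt_le_trans h /h.
by rewrite ltxx.
Qed.

Lemma adjoint_spec_unique T y z z' : densely_defined T ->
  adjoint_spec T y z -> adjoint_spec T y z' -> z = z'.
Proof.
move=> dT Tz Tz'; apply/eqP; rewrite -subr_eq0; apply/eqP.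
apply: dense_orthogonal dT _ => x Dx.
by rewrite innerBr -Tz // -Tz' // subrr.
Qed.

Lemma adjointE T y z : densely_defined T -> adjoint_spec T y z ->
  adjoint T y = z.
Proof.
move=> dT Tz; apply: (adjoint_spec_unique dT) (Tz).
exact: (xgetPex 0 (ex_intro _ z Tz)).
Qed.

(** Replaces the adjoint, which is defined by a choice of values, by the relation
    that it represents: in this form self-adjointness is transported by plain
    rewriting in the inner product. *)
Lemma self_adjointP A : self_adjoint A <->
  [/\ is_operator A, densely_defined A &
      forall y z, adjoint_spec A y z <-> dom A y /\ z = A y].
Proof.
split=> [[opA dA [domA AE]]|[opA dA AP]]; split=> //.
  move=> y z; split=> [Ayz|[Dy ->]].
    have Dy : dom (adjoint A) y by exists z.
    by rewrite -(adjointE dA Ayz) AE // -domA.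
  rewrite -domA in Dy; rewrite -AE //; have [u Ayu] := Dy.
  by rewrite (adjointE dA Ayu).
split=> [|y [z Ayz]]; last first.
  by rewrite (adjointE dA Ayz); have [_ ->] := (AP y z).1 Ayz.
apply/seteqP; split=> y /= => [[z /AP[]] //|Dy].
by exists (A y); exact/AP.
Qed.

Definition linear_map (L : H -> H) := forall (a : C) x y, L (a *: x + y) = a *: L x + L y.

Definition symmetric_map (L : H -> H) := forall x y, inner H (L x) y = inner H x (L y).

Definition add_map S (L : H -> H) : partialMap H :=
  PartialMap (dom S) (fun x => S x + L x).

(** A symmetric L defined everywhere can be moved across the inner product
    without changing any domain. *)
Lemma self_adjoint_add S L : self_adjoint S -> linear_map L -> symmetric_map L ->
  self_adjoint (add_map S L).
Proof.
move=> /self_adjointP[[S0 Sl SL] dS SP] Ll Lsym; apply/self_adjointP; split=> //.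
  split=> // a x y Dx Dy /=.
  by rewrite SL // Ll scalerDr addrACA.
move=> y z.
have addP : adjoint_spec (add_map S L) y z <-> adjoint_spec S y (z - L y).
  split=> h x Dx; have := h x Dx; rewrite /= innerDl innerBr Lsym.
    by move=> <-; rewrite addrK.
  by move=> ->; rewrite subrK.
by rewrite addP SP /=; split=> -[Dy e]; split=> //; rewrite -?e ?subrK // e addrK.
Qed.

Section Involution.
Variables (A : partialMap H) (J : H -> H).
Hypotheses (saA : self_adjoint A) (posA : positive_op A).
Hypotheses (Jlin : linear_map J) (Jsym : symmetric_map J) (JK : involutive J).

Let JB x y : J (x - y) = J x - J y.
Proof. by rewrite addrC -scaleN1r Jlin scaleN1r addrC. Qed.

Let Jnorm x : `|J x| = `|x|.
Proof.
have e : `|J x| ^+ 2 = `|x| ^+ 2 by rewrite -!inner_norm Jsym JK.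
by apply/eqP; rewrite -(@eqrXn2 _ 2) ?normr_ge0 // e.
Qed.

(** With A positive and J a symmetric involution, JA is the polar decomposition of
    the operator T that it defines: |T| is A, and |T*| is its conjugate JAJ. *)
Definition left_twist : partialMap H := PartialMap (dom A) (fun x => J (A x)).

Definition conj_twist : partialMap H :=
  PartialMap (J @^-1` dom A) (fun x => J (A (J x))).

Lemma left_twist_operator : is_operator left_twist.
Proof.
have [[A0 Al AL] _ _] := saA; split=> // a x y Dx Dy.
by rewrite /= AL // Jlin.
Qed.

Lemma left_twist_dense : densely_defined left_twist.
Proof. by case: saA. Qed.

Lemma left_twist_adjoint_spec y z :
  adjoint_spec left_twist y z <-> dom A (J y) /\ z = A (J y).
Proof.
have /self_adjointP[_ _ <-] := saA.
by split=> h x Dx; have := h x Dx; rewrite /= Jsym.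
Qed.

Lemma left_twist_adjoint_dom y : dom (adjoint left_twist) y <-> dom A (J y).
Proof.
split=> [[z /left_twist_adjoint_spec[] //]|Dy].
by exists (A (J y)); exact/left_twist_adjoint_spec.
Qed.

Lemma left_twist_adjointE y : dom A (J y) -> adjoint left_twist y = A (J y).
Proof.
move=> Dy; apply: adjointE left_twist_dense _.
exact/left_twist_adjoint_spec.
Qed.

(** Self-adjointness of A describes the graph of JA by linear equations, each of
    them continuous, without reference to the domain. *)
Lemma left_twist_graphE p : graph left_twist p <->
  forall w, dom A w -> inner H (A w) p.1 = inner H (J w) p.2.
Proof.
have /self_adjointP[_ _ AP] := saA; case: p => x y; rewrite /graph /=.
split=> [[Dx ->] w Dw|h].
  by rewrite Jsym JK; have /AP := conj Dx (erefl (A x)); exact.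
have /AP[Dx Jy] : adjoint_spec A x (J y) by move=> w Dw; rewrite h // Jsym.
by rewrite -Jy JK.
Qed.

(** A defect a - b in one of the equations of the graph would persist
    at a nearby point of the graph, where it is zero. *)
Lemma left_twist_closed : closed_op left_twist.
Proof.
move=> p clp; apply/left_twist_graphE => w Dw.
apply/eqP/negPn/negP; rewrite -subr_eq0 -normr_gt0.
set a := inner H _ _; set b := inner H _ _ => ab.
(* The defect moves by at most |A w| |p.1 - q.1| + |J w| |p.2 - q.2|; adding 1
   makes K positive and the final inequality strict. *)
pose K := `|A w| + `|J w| + 1.
have K0 : 0 < K by rewrite ltr_wpDl ?addr_ge0.
have [q [/left_twist_graphE/(_ _ Dw) Gq [/= q1 q2]]] :=
  clp _ (nbhsx_ballx p _ (divr_gt0 ab K0)).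
move: q1 q2; rewrite -!ball_normE /= => q1 q2.
have : `|a - b| <= `|A w| * (`|a - b| / K) + `|J w| * (`|a - b| / K).
  have {1}-> : a - b = inner H (A w) (p.1 - q.1) + inner H (J w) (q.2 - p.2).
    by rewrite !innerBr Gq addrA subrK.
  rewrite (le_trans (ler_normD _ _)) // lerD // (le_trans (inner_le _ _)) //.
    by rewrite ler_wpM2l // ltW.
  by rewrite distrC in q2; rewrite ler_wpM2l // ltW.
rewrite -mulrDl mulrCA ler_pMr // ler_pdivlMr // mul1r.
by rewrite /K gerDl ler10.
Qed.

Lemma conj_twist_self_adjoint : self_adjoint conj_twist.
Proof.
have /self_adjointP[[A0 Al AL] dA AP] := saA; apply/self_adjointP; split.
- have J0 : J 0 = 0.
    by have := Jlin (- 1) 0 0; rewrite scaler0 addr0 scaleN1r addNr.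
  split=> [|a x y|a x y]; rewrite /= ?J0 //.
    by rewrite Jlin; exact: Al.
  by move=> Dx Dy; rewrite Jlin AL // Jlin.
- move=> O [z Oz] oO; have /nbhs_ballP[e /= e0 zeO] := open_nbhs_nbhs (conj oO Oz).
  have [a [za Da]] : (ball (J z) e `&` dom A) !=set0.
    by apply: dA; [exists (J z); exact: ballxx|exact: ball_open].
  exists (J a); split; last by rewrite /= JK.
  by apply: zeO; move: za; rewrite -!ball_normE /= -Jnorm JB JK.
move=> y z; split=> [h|[Dy ->] x Dx].
  have /AP[Dy Jz] : adjoint_spec A (J y) (J z).
    by move=> x Dx; rewrite -!Jsym -(h (J x)) /= ?JK.
  by split=> //=; rewrite -Jz JK.
rewrite /= Jsym; have /AP := conj Dy (erefl (A (J y))) => ->; last by [].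
by rewrite Jsym.
Qed.

Lemma conj_twist_positive : positive_op conj_twist.
Proof. by move=> x Dx; rewrite /= Jsym; exact: posA. Qed.

Lemma left_twist_modulus : is_modulus left_twist A.
Proof.
split=> //; split=> [|x [Dx DAx]].
  apply/seteqP; split=> x /= [Dx DAx]; split=> //.
    by apply/left_twist_adjoint_dom; rewrite JK.
  by move/left_twist_adjoint_dom : DAx; rewrite JK.
have := @left_twist_adjointE (J (A x)); rewrite JK => /(_ DAx) e.
exact: esym e.
Qed.

Lemma left_twist_adjoint_modulus : is_adjoint_modulus left_twist conj_twist.
Proof.
split; [exact: conj_twist_self_adjoint|exact: conj_twist_positive|].
split=> [|x [Dx _]].
  apply/seteqP; split=> x [].
    move=> Dx DAx; have {}DAx : dom A (A (J x)) by rewrite -[A _]JK.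
    split; first exact/left_twist_adjoint_dom.
    by rewrite left_twist_adjointE.
  move=> /left_twist_adjoint_dom Dx.
  by rewrite left_twist_adjointE // => DAx; split=> //=; rewrite JK.
have e := left_twist_adjointE Dx.
by rewrite /comp_op [RHS](congr1 left_twist e) /= JK.
Qed.

End Involution.
End AbstractOperators.

(** * Diagonal operators on l^2 *)
Section SequenceOperators.
Variable R : realType.
Local Notation C := R[i].
Local Notation H := (ell2_hilbert R).
Implicit Types x y z : ell2 R.

(** The zero default only matters outside the domain of a partial operator. *)
Definition mk_ell2 (u : nat -> C) : ell2 R :=
  if pselect (square_summable u) is left h then Ell2 h else 0.

Lemma mk_ell2E u i : square_summable u -> mk_ell2 u i = u i.
Proof. by rewrite /mk_ell2; case: pselect. Qed.

Lemma coord_square_summable u x : x =1 u -> square_summable u.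
Proof. by move=> /funext <-; exact: coord_l2. Qed.

Lemma eq_inner2 x y x' y' :
  (forall i, x i * conjc (y i) = x' i * conjc (y' i)) -> inner2 x y = inner2 x' y'.
Proof. by move=> e; congr csum; apply/funext. Qed.

Lemma inner2_scalel a x y : inner2 (a *: x) y = a * inner2 x y.
Proof. exact: inner2_Zl. Qed.

Fact basis_subproof j : square_summable (fun i => (i == j)%:R : C).
Proof.
exists 1 => n; have [jn|nj] := ltnP j n.
  rewrite (bigD1 (Ordinal jn)) //= eqxx big1 ?addr0 => [|i ij].
    by rewrite /sqmod /= expr1n expr0n addr0.
  by rewrite -val_eqE /= in ij; rewrite (negbTE ij) /sqmod /= expr0n addr0.
rewrite big1 ?ler01 // => i _; rewrite ltn_eqF; last exact: leq_trans nj.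
by rewrite /sqmod /= expr0n addr0.
Qed.

Definition basis j : ell2 R := Ell2 (basis_subproof j).

Lemma inner_basisr x j : inner2 x (basis j) = x j.
Proof.
rewrite /inner2 (@csum_single _ _ j) => [|i ij] /=.
  by rewrite eqxx conjc1 mulr1.
by rewrite (negbTE ij) conjc0 mulr0.
Qed.

Lemma inner_basisl x j : inner2 (basis j) x = conjc (x j).
Proof. by rewrite inner2C inner_basisr. Qed.

Definition truncate n (u : nat -> C) : ell2 R := \sum_(j < n) u j *: basis j.

Lemma truncateE n u i : truncate n u i = if (i < n)%N then u i else 0.
Proof.
rewrite /truncate; elim: n => [|n IHn]; first by rewrite big_ord0 coord0.
rewrite big_ord_recr coordD IHn coordZ /= [in RHS]ltnS [in RHS]leq_eqVlt.
by case: (eqVneq i n) => [->|_]; rewrite ?ltnn ?add0r ?mulr1 ?mulr0 ?addr0.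
Qed.

(** The tail of a convergent series of nonnegative terms tends to zero. *)
Lemma truncate_approx x (r : R) : 0 < r ->
  exists n, `|x - truncate n x| <= r%:C.
Proof.
move=> r0; have r20 : 0 < r ^+ 2 by rewrite exprn_gt0.
have cx : cvgn (series (fun i => sqmod (x i))).
  by apply: bounded_sums_cvg => [i|]; [exact: sqmod_ge0|exact: coord_l2].
(* Beyond such an n, the partial sums leave less than r^2 to the tail. *)
have [n _ /(_ n (leqnn n)) xn] : \forall n \near \oo,
    sum_sqmod x - r ^+ 2 < series (fun i => sqmod (x i)) n.
  by apply: (cvgr_gt _ cx); rewrite ltrBlDr ltrDl.
exists n; apply/ell2_norm_leP => [|m]; first exact: ltW.
rewrite series_ord in xn.
have := partial_sum_sqmod x (n + m); rewrite big_split_ord /= => xnm.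
apply: (@le_trans _ _ (\sum_(i < m) sqmod (x (n + i)%N))); last by lra.
pose f i := sqmod ((x - truncate n x) i).
have f0 i : 0 <= f i by exact: sqmod_ge0.
apply: (@le_trans _ _ (\sum_(i < n + m) f i)).
  rewrite addnC big_split_ord /= lerDl sumr_ge0 // => i _; exact: f0.
rewrite big_split_ord /= big1 ?add0r => [|i _].
  apply: ler_sum => i _; rewrite /f coordB truncateE ltnNge leq_addr /=.
  by rewrite subr0.
by rewrite /f coordB truncateE ltn_ord subrr /sqmod /= expr0n addr0.
Qed.

Lemma dense_truncate (D : set H) : (forall n x, D (truncate n x)) -> dense D.
Proof.
move=> Dt O [x Ox] oO.
have /nbhs_ballP[e /= e0 xeO] := open_nbhs_nbhs (conj oO Ox).
have [r r0 er] := real_gt0_complex e0.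
have r20 : 0 < r / 2 by rewrite divr_gt0.
have [n xn] := truncate_approx x r20.
exists (truncate n x); split=> //; apply: xeO.
rewrite -ball_normE /= er; apply: le_lt_trans xn _.
by rewrite ltcR ltr_pdivrMr // ltr_pMr // ltr1n.
Qed.

(** A bounded functional is determined by its values on the unit vectors, whose
    span contains all truncations. *)
Lemma functional_eq0 (phi : ell2 R -> C) (K : R) : 0 <= K ->
  (forall a x y, phi (a *: x + y) = a * phi x + phi y) ->
  (forall x, `|phi x| <= K%:C * `|x|) -> (forall j, phi (basis j) = 0) ->
  forall x, phi x = 0.
Proof.
move=> K0 phil phiK phi0 x.
have phi00 : phi 0 = 0.
  by apply/eqP; rewrite -normr_le0 (le_trans (phiK 0)) // normr0 mulr0.
have phit n : phi (truncate n x) = 0.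
  rewrite /truncate; elim: n => [|n IHn]; first by rewrite big_ord0.
  by rewrite big_ord_recr /= addrC phil phi0 mulr0 add0r IHn.
apply/eqP/negPn/negP; rewrite -normr_gt0 => /real_gt0_complex[p p0 xp].
have K10 : 0 < K + 1 by rewrite ltr_wpDl.
have [n xn] := truncate_approx x (divr_gt0 p0 K10).
have : p%:C <= (K * (p / (K + 1)))%:C.
  rewrite -xp -[x](subrK (truncate n x)) -[x - _]scale1r phil mul1r phit addr0.
  rewrite (le_trans (phiK _)) // rmorphM ler_wpM2l // ler0c //.
rewrite lecR mulrCA ler_pMr // ler_pdivlMr // mul1r.
by rewrite gerDl ler10.
Qed.

Section Diagonal.
Variable s : nat -> R.

Definition diag_seq x i : C := (s i)%:C * x i.

Definition diag_op : partialMap H :=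
  PartialMap [set x : ell2 R | square_summable (diag_seq x)]
             (fun x => mk_ell2 (diag_seq x)).

Lemma diag_opE x i : dom diag_op x -> diag_op x i = (s i)%:C * x i.
Proof. by move=> Dx; rewrite /= mk_ell2E. Qed.

(** Exhibiting the image y of x is enough: as an element of the space, y is
    square-summable. *)
Lemma diag_op_dom x y : (forall i, y i = (s i)%:C * x i) -> dom diag_op x.
Proof. exact: coord_square_summable. Qed.

Lemma diag_op_eq x y : (forall i, y i = (s i)%:C * x i) -> diag_op x = y.
Proof.
by move=> yE; apply: ell2_ext => i; rewrite diag_opE ?yE //; exact: diag_op_dom yE.
Qed.

Lemma diag_opD x y : dom diag_op x -> dom diag_op y ->
  dom diag_op (x + y) /\
  diag_op (x + y) = (diag_op x : ell2 R) + diag_op y :> ell2 R.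
Proof.
move=> Dx Dy.
have e i : (diag_op x + diag_op y : ell2 R) i = (s i)%:C * (x + y) i.
  by rewrite !coordD !diag_opE // mulrDr.
by split; [exact: diag_op_dom e|exact: diag_op_eq e].
Qed.

Lemma diag_opN x : dom diag_op x ->
  dom diag_op (- x) /\ diag_op (- x) = - (diag_op x : ell2 R) :> ell2 R.
Proof.
move=> Dx; have e i : (- (diag_op x : ell2 R)) i = (s i)%:C * (- x) i.
  by rewrite !coordN diag_opE // mulrN.
by split; [exact: diag_op_dom e|exact: diag_op_eq e].
Qed.

Lemma diag_op_half x : dom diag_op (x + x) -> dom diag_op x.
Proof.
move=> Dxx; apply: (@diag_op_dom _ (2^-1 *: (diag_op (x + x) : ell2 R))) => i.
by rewrite coordZ diag_opE // coordD; field.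
Qed.

Lemma diag_operator : is_operator diag_op.
Proof.
have lin (a : C) x y : dom diag_op x -> dom diag_op y ->
    forall i, (a *: (diag_op x : ell2 R) + diag_op y : ell2 R) i =
      (s i)%:C * (a *: x + y) i.
  move=> Dx Dy i; rewrite !coordD !coordZ !diag_opE //.
  by rewrite mulrDr mulrCA.
split=> [|a x y Dx Dy|a x y Dx Dy].
- by apply: (@diag_op_dom 0 0) => i; rewrite coord0 mulr0.
- exact: diag_op_dom (lin a x y Dx Dy).
- exact: diag_op_eq (lin a x y Dx Dy).
Qed.

Lemma diag_truncateE n (u : nat -> C) i :
  truncate n (fun j => (s j)%:C * u j) i = (s i)%:C * truncate n u i.
Proof. by rewrite !truncateE; case: ifP => // _; rewrite mulr0. Qed.

Lemma diag_basisE j i : ((s j)%:C *: basis j) i = (s i)%:C * basis j i.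
Proof. by rewrite coordZ /=; case: eqVneq => [->|]; rewrite ?mulr0. Qed.

Lemma diag_dense : densely_defined diag_op.
Proof.
by apply: dense_truncate => n x; exact: diag_op_dom (diag_truncateE n x).
Qed.

(** Testing the adjoint relation on the unit vectors determines all coordinates of
    z, and z being square-summable puts y in the domain. *)
Lemma diag_self_adjoint : self_adjoint diag_op.
Proof.
apply/self_adjointP; split; [exact: diag_operator|exact: diag_dense|].
move=> y z; split=> [h|[Dy ->] x Dx].
  suff zE i : z i = (s i)%:C * y i.
    by split; [exact: diag_op_dom zE|exact/esym/diag_op_eq].
  have := h _ (diag_op_dom (diag_basisE i)); rewrite (diag_op_eq (diag_basisE i)).
  rewrite -[inner H _ _]/(inner2 _ _) -[inner H (basis i) z]/(inner2 _ _).
  rewrite inner2_scalel !inner_basisl => /(congr1 conjc).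
  by rewrite rmorphM /= !conjcK oppr0 => <-.
apply: eq_inner2 => i.
by rewrite !diag_opE // rmorphM /= oppr0 mulrCA mulrA.
Qed.

End Diagonal.

End SequenceOperators.

(** * Bounded operators given by a real symmetric matrix *)
Section MatrixOperator.
Variable R : realType.
Local Notation C := R[i].
Local Notation H := (ell2_hilbert R).
Implicit Types x y z : ell2 R.
Variables (d : nat -> nat -> R) (beta : nat -> R).
(* A Hilbert-Schmidt bound: the sum of all (d i j)^2 is at most 1, so the operator
   is a contraction.  Bounding by a product keeps all the sums simple ones. *)
Hypotheses (beta0 : forall i, 0 <= beta i) (beta1 : forall n, \sum_(i < n) beta i <= 1).
Hypothesis dsym : forall i j, d i j = d j i.
Hypothesis dbeta : forall i j, d i j ^+ 2 <= beta i * beta j.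

Lemma sqmod_real (a : R) : sqmod a%:C = a ^+ 2.
Proof. by rewrite /sqmod /= expr0n addr0. Qed.

Fact mx_row_sum i n : \sum_(j < n) sqmod (d i j)%:C <= beta i.
Proof.
under eq_bigr => j _ do rewrite sqmod_real.
apply: (@le_trans _ _ (\sum_(j < n) beta i * beta j)).
  by apply: ler_sum => j _; exact: dbeta.
by rewrite -mulr_sumr ler_piMr.
Qed.

Fact mx_row_subproof i : square_summable (fun j => (d i j)%:C).
Proof. by exists (beta i) => n; exact: mx_row_sum. Qed.

Definition mx_row i : ell2 R := Ell2 (mx_row_subproof i).

Definition mx_op x : ell2 R := mk_ell2 (fun i => inner2 x (mx_row i)).

Lemma sqmod_inner2_le x y : sqmod (inner2 x y) <= sum_sqmod x * sum_sqmod y.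
Proof.
rewrite -lecR sqmodE rmorphM /= -!sum_sqmodE; exact: dot_CauchySchwarz.
Qed.

Fact mx_op_sum x n : \sum_(i < n) sqmod (inner2 x (mx_row i)) <= sum_sqmod x.
Proof.
have x0 : 0 <= sum_sqmod x by apply: le_trans (partial_sum_sqmod x 0); rewrite big_ord0.
apply: (@le_trans _ _ (\sum_(i < n) sum_sqmod x * beta i)).
  apply: ler_sum => i _; rewrite (le_trans (sqmod_inner2_le _ _)) // ler_wpM2l //.
  by apply: sum_sqmod_le => m; exact: mx_row_sum.
by rewrite -mulr_sumr ler_piMr.
Qed.

Lemma mx_opE x i : mx_op x i = inner2 x (mx_row i).
Proof. by rewrite mk_ell2E //; exists (sum_sqmod x) => n; exact: mx_op_sum. Qed.

Lemma mx_op_linear : linear_map (mx_op : H -> H).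
Proof.
move=> a x y; apply: ell2_ext => i.
by rewrite coordD coordZ !mx_opE inner2_linl.
Qed.

Lemma mx_opB x y : mx_op (x - y) = mx_op x - mx_op y.
Proof. by apply: ell2_ext => i; rewrite coordB !mx_opE; exact: inner2_Bl. Qed.

Lemma mx_opD x y : mx_op (x + y) = mx_op x + mx_op y.
Proof. by apply: ell2_ext => i; rewrite coordD !mx_opE; exact: (@innerDl _ H). Qed.

Lemma mx_op_norm_le x : `|mx_op x| <= `|x|.
Proof.
rewrite -(@ler_sqr C) ?nnegrE // -!ell2_normE !sum_sqmodE lecR.
by apply: sum_sqmod_le => n; under eq_bigr => i _ do rewrite mx_opE; exact: mx_op_sum.
Qed.

Lemma mx_op_basis j : mx_op (basis R j) = mx_row j.
Proof.
by apply: ell2_ext => i; rewrite mx_opE inner_basisl conjc_real /= dsym.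
Qed.

(** For y fixed, both sides are bounded functionals of x that agree on the unit
    vectors, which are mapped to the rows; this stands in for the interchange of
    two infinite sums. *)
Lemma mx_op_symmetric : symmetric_map (mx_op : H -> H).
Proof.
move=> x y; apply/eqP; rewrite -subr_eq0; apply/eqP.
pose phi x := inner2 (mx_op x) y - inner2 x (mx_op y).
have [k k0 yk] : exists2 k, 0 <= k & `|y| = k%:C.
  move: (normr_ge0 y); case: `|y| => k l; rewrite lecE /= => /andP[/eqP -> k0].
  by exists k.
apply: (@functional_eq0 _ phi (2 * k)) => [|a u v|u|j]; first by rewrite mulr_ge0.
- rewrite /phi mx_op_linear !inner2_linl; ring.
- rewrite /phi (le_trans (ler_normB _ _)) // (_ : _%:C * _ = `|u| * k%:C + `|u| * k%:C).
    rewrite -yk lerD // (le_trans (@inner_le _ H _ _)) //.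
      by rewrite ler_wpM2r // mx_op_norm_le.
    by rewrite ler_wpM2l // mx_op_norm_le.
  by rewrite rmorphM rmorph_nat; ring.
by rewrite /phi mx_op_basis inner_basisl mx_opE -inner2C subrr.
Qed.

End MatrixOperator.

(** * The sign involution *)
Section SignFlip.
Variable R : realType.
Local Notation C := R[i].
Local Notation H := (ell2_hilbert R).
Implicit Types x y z : ell2 R.

Fact sign_subproof x : square_summable (fun i => (-1) ^+ i * x i).
Proof.
have [M xM] := coord_l2 x; exists M => n; apply: le_trans (xM n).
apply: ler_sum => i _; rewrite sqmodM -signr_odd.
by case: odd; rewrite /sqmod /= ?oppr0 ?sqrrN expr1n expr0n addr0 mul1r.
Qed.

Definition sign_flip x : ell2 R := Ell2 (sign_subproof x).

Lemma sign_flipE x i : sign_flip x i = (-1) ^+ i * x i.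
Proof. by []. Qed.

Lemma sign_flip_linear : linear_map (sign_flip : H -> H).
Proof.
move=> a x y; apply: ell2_ext => i.
by rewrite !(sign_flipE, coordD, coordZ) mulrDr mulrCA.
Qed.

Lemma conjc_sign i : conjc ((-1) ^+ i : C) = (-1) ^+ i.
Proof. by rewrite rmorphXn rmorphN1. Qed.

Lemma sign_flip_symmetric : symmetric_map (sign_flip : H -> H).
Proof.
move=> x y; apply: eq_inner2 => i /=.
by rewrite rmorphM /= conjc_sign mulrCA mulrA.
Qed.

Lemma sign_flipK : involutive sign_flip.
Proof.
by move=> x; apply: ell2_ext => i /=; rewrite mulrA -expr2 sqrr_sign mul1r.
Qed.

End SignFlip.

(** * The counterexample *)
Section Counterexample.
Variable R : realType.
Local Notation C := R[i].
Local Notation H := (ell2_hilbert R).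
Implicit Types x y z : ell2 R.

Definition weight i : R := 2 ^+ i.
Definition eigval i : R := 16 ^+ i.
(** The beta_i = w_i^2 / (2 s_i) are such that (entry i j)^2 <= beta_i beta_j, by
    the inequality of arithmetic and geometric means for s_i and s_j. *)
Definition beta i : R := 4 ^- i / 2.
Definition entry i j : R :=
  if odd (i + j) then weight i * weight j / (eigval i + eigval j) else 0.

Lemma eigval_gt0 i : 0 < eigval i.
Proof. by rewrite exprn_gt0. Qed.

Lemma weight_gt0 i : 0 < weight i.
Proof. by rewrite exprn_gt0. Qed.

Lemma eigval_add_neq0 i j : eigval i + eigval j != 0.
Proof. by rewrite gt_eqF // addr_gt0 ?eigval_gt0. Qed.

Lemma eigval_ge1 i : 1 <= eigval i.
Proof. by rewrite exprn_ege1 // ler1n. Qed.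

Lemma betaE k : beta k = weight k ^+ 2 / (2 * eigval k).
Proof.
rewrite /beta /weight /eigval (_ : 16 = 4 * 4) ?exprMn; last by rewrite -natrM.
rewrite -exprM mulnC exprM (_ : 2 ^+ 2 = 4); last by rewrite -natrX.
by field; rewrite expf_neq0.
Qed.

Lemma beta_ge0 i : 0 <= beta i.
Proof. by rewrite divr_ge0 // invr_ge0 exprn_ge0. Qed.

Lemma beta_sum n : \sum_(i < n) beta i <= 1.
Proof.
(* Not the exact sum, but a bound with a short induction. *)
have : \sum_(i < n) beta i <= 1 - 4 ^- n; last first.
  by move=> h; apply: le_trans h _; rewrite gerBl invr_ge0 exprn_ge0.
elim: n => [|n IHn]; first by rewrite big_ord0 expr0 invr1 subrr.
rewrite big_ord_recr /= /beta.
have : (4 ^- n.+1 : R) = 4 ^- n / 4 by rewrite exprS invfM mulrC.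
have : (0 : R) <= 4 ^- n by rewrite invr_ge0 exprn_ge0.
by move=> h ->; lra.
Qed.

Lemma entryC i j : entry i j = entry j i.
Proof. by rewrite /entry addnC [eigval j + _]addrC [weight j * _]mulrC. Qed.

Lemma entry_bound i j : entry i j ^+ 2 <= beta i * beta j.
Proof.
rewrite /entry; case: ifP => _; last by rewrite expr0n mulr_ge0 ?beta_ge0.
have s0 : 0 < (eigval i + eigval j) ^+ 2 by rewrite exprn_gt0 // addr_gt0 ?eigval_gt0.
rewrite expr_div_n ler_pdivrMr //.
rewrite !betaE; have := eigval_gt0 i; have := eigval_gt0 j.
move: (eigval i) (eigval j) (weight i) (weight j) s0 => a b u v s0 b0 a0.
rewrite (_ : _ * _ * (a + b) ^+ 2 =
  (u * v) ^+ 2 * ((a + b) ^+ 2 / (4 * a * b))); last first.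
  by field; rewrite !gt_eqF.
rewrite ler_peMr ?sqr_ge0 // ler_pdivlMr ?mulr_gt0 // mul1r -subr_ge0.
by rewrite (_ : _ - _ = (a - b) ^+ 2) ?sqr_ge0 //; ring.
Qed.

Let S := diag_op eigval.
Let D := mx_op beta_ge0 beta_sum entry_bound.
Let row := mx_row beta_ge0 beta_sum entry_bound.
Let J := @sign_flip R.

Lemma sign_flip_entry i j : (-1) ^+ j * entry i j = - ((-1) ^+ i * entry i j).
Proof.
rewrite /entry -(signr_odd _ i) -(signr_odd _ j) oddD.
by case: odd; case: odd; rewrite /= ?mulr0 ?oppr0 // ?mulNr ?opprK.
Qed.

Lemma sign_flip_mx_op x : D (J x) = - J (D x).
Proof.
apply: ell2_ext => i; rewrite coordN sign_flipE !mx_opE -mulNr.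
rewrite -inner2_scalel; apply: eq_inner2 => j.
rewrite sign_flipE coordZ mulrAC [RHS]mulrAC; congr (_ * _).
rewrite /= oppr0 mulNr -[(-1) ^+ j](rmorph_sign (real_complex R)).
rewrite -[(-1) ^+ i](rmorph_sign (real_complex R)) -!rmorphM sign_flip_entry.
by rewrite rmorphN.
Qed.

Fact off_parity_subproof (p : bool) :
  square_summable (fun j => (if odd j == p then 0 else weight j / eigval j)%:C).
Proof.
exists 2 => n; apply: (@le_trans _ _ (\sum_(j < n) 2 * beta j)); last first.
  by rewrite -mulr_sumr ler_piMr // beta_sum.
apply: ler_sum => j _; rewrite sqmod_real; case: ifP => _.
  by rewrite expr0n mulr_ge0 ?beta_ge0.
have s0 := eigval_gt0 j; have s1 := eigval_ge1 j.
rewrite betaE (_ : 2 * _ = weight j ^+ 2 / eigval j); last by field; rewrite gt_eqF.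
rewrite expr_div_n ler_wpM2l ?sqr_ge0 // lef_pV2 ?posrE ?exprn_gt0 //.
by rewrite expr2 ler_peMr // ltW.
Qed.

(** The vector v_p with <Sx, v_p> = sum of w_j x_j over the j of parity different
    from p.  The w_j are not square-summable, but the w_j / s_j are: the functional
    is bounded in Sx, not in x. *)
Definition off_parity p : ell2 R := Ell2 (off_parity_subproof p).

(** This is (s_i + s_j) entry i j = w_i w_j for opposite parities, in the form in
    which s_i is moved from one argument of the inner product to the other. *)
Lemma entry_off_parity i j :
  eigval i * entry i j =
  eigval j * (weight i * (if odd j == odd i then 0 else weight j / eigval j) - entry i j).
Proof.
rewrite /entry oddD; have := eigval_add_neq0 i j; have := eigval_gt0 j.
case: odd; case: odd => /=; rewrite ?mulr0 ?subr0 ?mulr0 // => s0 s1;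
  by field; rewrite s1 gt_eqF.
Qed.

Let simp0 := (mulr0, mul0r, subr0, addr0, oppr0, add0r).

Lemma anticommutator_coord x i : dom S x ->
  (eigval i)%:C * D x i + D (S x) i =
  (weight i)%:C * inner2 (S x : ell2 R) (off_parity (odd i)).
Proof.
move=> Dx; rewrite !mx_opE.
have scaler (a : R) u v : inner2 u (a%:C *: v) = a%:C * inner2 u v.
  by rewrite (inner2_Zr u a%:C v : _ = conjc a%:C * _) conjc_real.
rewrite -!scaler; apply/esym/eqP; rewrite -subr_eq -(inner2_Br (S x)) eq_sym; apply/eqP.
apply: eq_inner2 => j; rewrite coordB !coordZ diag_opE //.
rewrite [_ * x j]mulrC -!mulrA; congr (_ * _).
by apply/eqP; rewrite eq_complex /= !simp0 entry_off_parity !eqxx.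
Qed.

(** Each parity class contains indices with w_i arbitrarily large. *)
Lemma weighted_sequence_eq0 (c : bool -> C) :
  square_summable (fun i => (weight i)%:C * c (odd i)) -> forall p, c p = 0.
Proof.
move=> [M cM] p; apply/sqmod_eq0/eqP; rewrite -[_ == _]negbK; apply/negP => cp.
have c0 : 0 < sqmod (c p) by rewrite lt_neqAle eq_sym cp sqmod_ge0.
have [n op Mn] : exists2 n, odd n = p & (Num.bound (M / sqmod (c p)) <= n)%N.
  exists ((Num.bound (M / sqmod (c p))).*2 + p)%N; last by lia.
  by rewrite oddD odd_double; case: (p).
have := cM n.+1; rewrite big_ord_recr /= sqmodM sqmod_real op => h.
have {}h : weight n ^+ 2 * sqmod (c p) <= M.
  by apply: le_trans h; rewrite lerDr sumr_ge0 // => i _; exact: sqmod_ge0.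
move: h; rewrite -ler_pdivlMr // leNgt => /negP; apply.
apply: (lt_le_trans (archi_boundP _)).
  by rewrite divr_ge0 ?sqmod_ge0 // (le_trans _ (cM 0)) // big_ord0.
rewrite /weight -exprM -natrX ler_nat.
rewrite (leq_trans Mn) // (leq_trans _ (ltnW (ltn_expl _ _))) //.
by rewrite leq_pmulr.
Qed.

(** The natural domains leave no room for a nonzero anticommutator: its coordinates
    are w_i times a constant for each parity, and they must be square-summable. *)
Lemma anticommutator_eq0 x : dom S x -> dom S (D x) -> S (D x) + D (S x) = 0 :> H.
Proof.
move=> Dx DDx.
have e i : (S (D x) + D (S x) : ell2 R) i =
    (weight i)%:C * inner2 (S x : ell2 R) (off_parity (odd i)).
  by rewrite coordD diag_opE // anticommutator_coord.
apply: ell2_ext => i; rewrite e coord0.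
have -> := @weighted_sequence_eq0 (fun p => inner2 (S x : ell2 R) (off_parity p))
  (coord_square_summable e).
by rewrite mulr0.
Qed.

(** Conversely, if both linear constraints hold, then the sequence s_i (Dx)_i is
    that of -DSx, which is square-summable. *)
Lemma mx_op_dom x : dom S x ->
  (forall p, inner2 (S x : ell2 R) (off_parity p) = 0) -> dom S (D x).
Proof.
move=> Dx x0; apply: (@diag_op_dom _ _ _ (- D (S x))) => i.
apply/esym/eqP; rewrite coordN -addr_eq0 anticommutator_coord // x0 mulr0.
by [].
Qed.

Lemma diag_inner_ge x : dom S x -> `|x| ^+ 2 <= inner2 (S x : ell2 R) x.
Proof.
move=> Dx; have [cS _] := inner2_csummable (S x) x.
have e : (fun i => (S x : ell2 R) i * conjc (x i)) =
    fun i => (eigval i * sqmod (x i))%:C.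
  apply/funext => i; rewrite diag_opE // /sqmod.
  by case: (x i) => p q; apply/eqP; rewrite eq_complex /=; apply/andP; split;
    apply/eqP; ring.
rewrite -ell2_normE sum_sqmodE /inner2 e csum_real lecR.
apply: lim_series_le => [||i].
- by apply: bounded_sums_cvg => [i|]; [exact: sqmod_ge0|exact: coord_l2].
- suff -> : (fun i => eigval i * sqmod (x i)) =
      fun i => re ((S x : ell2 R) i * conjc (x i)) by exact: cS.
  apply/funext => i.
  by rewrite -[eigval i * _]/(re ((fun i => (eigval i * sqmod (x i))%:C) i)) -e.
by apply: ler_peMl; [exact: sqmod_ge0|exact: eigval_ge1].
Qed.

Let A : partialMap H := add_map S (D : H -> H).

(** |<Dx, x>| <= |x|^2 <= <Sx, x>, because D is a contraction and s_i >= 1. *)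
Lemma perturbed_positive : positive_op A.
Proof.
move=> x Dx; rewrite (innerDl (S x : H) (D x) x : inner H (A x) x = _).
set d := inner H (D x) x.
have dr : d \is Num.real.
  by rewrite CrealE -inner_conj /d (mx_op_symmetric _ _ entryC).
have : `|d| <= `|x| ^+ 2.
  by rewrite (le_trans (inner_le _ _)) // expr2 ler_wpM2r // mx_op_norm_le.
rewrite real_ler_norml // => /andP[dx _].
rewrite -(subrr (`|x| ^+ 2)) lerD //; exact: diag_inner_ge.
Qed.

Lemma perturbed_self_adjoint : self_adjoint A.
Proof.
apply: self_adjoint_add; first exact: diag_self_adjoint.
  exact: mx_op_linear.
by apply: mx_op_symmetric; exact: entryC.
Qed.

Lemma sign_flip_diag x : dom S x -> dom S (J x) /\ S (J x) = J (S x).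
Proof.
move=> Dx; have e i : J (S x) i = (eigval i)%:C * J x i.
  by rewrite !sign_flipE diag_opE // mulrCA.
by split; [exact: diag_op_dom e|exact: diag_op_eq e].
Qed.

Let B : partialMap H := conj_twist A J.

Lemma perturbed_conj_dom x : dom B x <-> dom S x.
Proof.
split=> [/sign_flip_diag[]|/sign_flip_diag[] //].
by rewrite /J sign_flipK.
Qed.

Lemma perturbed_conjE x : dom S x -> B x = (S x : ell2 R) - D x :> ell2 R.
Proof.
move=> Dx; have [_ SJ] := sign_flip_diag Dx.
have -> : B x = J (J (S x) - J (D x)) by rewrite -SJ -sign_flip_mx_op.
apply: ell2_ext => i; rewrite sign_flipE !coordB !sign_flipE.
by rewrite -mulrBr mulrA -expr2 sqrr_sign mul1r.
Qed.

Let DsubE x y : D (x - y) = D x - D y.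
Proof. exact: mx_opB. Qed.

Let DaddE x y : D (x + y) = D x + D y.
Proof. exact: mx_opD. Qed.

Lemma square_algebra (p q t : ell2 R) :
  p - q - (- q - t) = p + q + (- q + t).
Proof. by apply: ell2_ext => i; rewrite !(coordD, coordN); ring. Qed.

Lemma commutator_algebra (p r t : ell2 R) :
  p - - r + (r - t) - (p + - r - (r + t)) = 4 *: r.
Proof. by apply: ell2_ext => i; rewrite !(coordD, coordN, coordZ); ring. Qed.

(** From (S + D)x and (S - D)x in the domain of S, half their sum Sx and
    then Dx are in it; so both squares expand, and the cross terms
    SDx + DSx cancel. *)
Lemma square_difference x : dom (comp_op A A) x -> dom (comp_op B B) x ->
  B (B x) = A (A x).
Proof.
move=> [Dx DA] [_ DB]; rewrite -/(dom S x) in Dx.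
move/perturbed_conj_dom : DB => DB.
rewrite perturbed_conjE // in DB *.
have AE y : A y = (S y : ell2 R) + D y :> ell2 R by [].
rewrite !AE in DA *.
have DSx : dom S (S x).
  by have [+ _] := diag_opD DA DB; rewrite addrACA subrr addr0 => /diag_op_half.
have DDx : dom S (D x).
  have [+ _] := diag_opN DSx; move=> /(diag_opD DA)[+ _].
  by rewrite addrAC subrr add0r.
have ac : D (S x) = - (S (D x) : ell2 R) :> ell2 R.
  by apply/eqP; rewrite -addr_eq0 addrC; apply/eqP; exact: anticommutator_eq0.
rewrite perturbed_conjE //.
have [DN SDxN] := diag_opN DDx.
rewrite (diag_opD DSx DN).2 (diag_opD DSx DDx).2 SDxN DsubE DaddE.
rewrite ac; exact: square_algebra.
Qed.

Lemma commutator x : dom S x -> dom S (S x) -> dom S (D x) ->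
  dom (sub_op (comp_op A B) (comp_op B A)) x /\
  sub_op (comp_op A B) (comp_op B A) x = 4 *: D (S x) :> ell2 R.
Proof.
move=> Dx DSx DDx.
have ac : S (D x) = - D (S x) :> ell2 R.
  by apply/eqP; rewrite -addr_eq0; apply/eqP; exact: anticommutator_eq0.
have AE y : A y = (S y : ell2 R) + D y :> ell2 R by [].
have [DN SDxN] := diag_opN DDx.
have DB : dom S (B x) by rewrite perturbed_conjE //; exact: (diag_opD DSx DN).1.
have DA : dom S (A x) by exact: (diag_opD DSx DDx).1.
split.
  split; split=> //; first exact/perturbed_conj_dom.
  by apply/perturbed_conj_dom.
have -> : sub_op (comp_op A B) (comp_op B A) x =
    (A (B x) : ell2 R) - B (A x) :> ell2 R by [].
rewrite (perturbed_conjE DA) (AE (B x)) perturbed_conjE // AE (diag_opD DSx DN).2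
  (diag_opD DSx DDx).2 SDxN DsubE DaddE.
rewrite ac; exact: commutator_algebra.
Qed.

Lemma off_parityE p j :
  off_parity p j = (if odd j == p then 0 else weight j / eigval j)%:C.
Proof. by []. Qed.

Lemma weight0 : weight 0 = 1.
Proof. exact: expr0. Qed.

Lemma mx_rowE i j : row i j = (entry i j)%:C.
Proof. by []. Qed.

Lemma eigval0 : eigval 0 = 1.
Proof. exact: expr0. Qed.

(** The coefficient of the second term makes w_0 x_0 + w_n x_n vanish, so that for n
    even both linear constraints hold. *)
Definition test_vector n : ell2 R := basis R 0 - (weight n)^-1%:C *: basis R n.

Lemma diag_two_basis n (c : R) :
  dom S (basis R 0 - c%:C *: basis R n) /\
  S (basis R 0 - c%:C *: basis R n) =
    basis R 0 - (eigval n * c)%:C *: basis R n :> ell2 R.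
Proof.
have e i : (basis R 0 - (eigval n * c)%:C *: basis R n) i =
    (eigval i)%:C * (basis R 0 - c%:C *: basis R n) i.
  have b j : (eigval j)%:C * basis R j i = (eigval i)%:C * basis R j i.
    by rewrite -diag_basisE coordZ.
  rewrite !coordB !coordZ mulrBr -(b 0) eigval0 mul1r.
  congr (_ - _); rewrite [RHS]mulrCA -(b n) rmorphM [RHS]mulrA; congr (_ * _).
  exact: mulrC.
by split; [exact: diag_op_dom e|exact: diag_op_eq e].
Qed.

Lemma inner_two_basis n (c : R) y :
  inner2 (basis R 0 - c%:C *: basis R n) y = conjc (y 0) - c%:C * conjc (y n).
Proof.
by rewrite (inner2_Bl y (basis R 0) _ : _ = _ - _) inner2_scalel !inner_basisl.
Qed.

Lemma norm_basis j : `|basis R j| = 1.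
Proof.
apply/eqP; rewrite -(@eqrXn2 _ 2) // expr1n -ell2_normE inner_basisl /= eqxx.
by rewrite conjc1.
Qed.

Lemma weight_ge1 i : 1 <= weight i.
Proof. by rewrite exprn_ege1 // ler1n. Qed.

Lemma norm_test_vector n : `|test_vector n| <= 2.
Proof.
rewrite (le_trans (ler_normB _ _)) // normrZ !norm_basis mulr1.
rewrite (_ : 2 = 1 + 1) ?lerD2l // ger0_norm; last first.
  by rewrite ler0c invr_ge0 ltW ?weight_gt0.
have : (weight n)^-1%:C <= 1%:C :> C.
  by rewrite lecR invf_le1 ?weight_gt0 // weight_ge1.
exact.
Qed.

Lemma test_domain n : ~~ odd n ->
  [/\ dom S (test_vector n), dom S (S (test_vector n)) & dom S (D (test_vector n))].
Proof.
move=> en; have [Dt St] := diag_two_basis n (weight n)^-1.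
split=> //; first by rewrite St; exact: (diag_two_basis _ _).1.
apply: mx_op_dom => // p.
rewrite St inner_two_basis !off_parityE !conjc_real -rmorphM -rmorphB (negbTE en).
case: p => /=; last by rewrite mulr0 subr0.
rewrite weight0 eigval0 (_ : _ - _ = 0) //.
by field; rewrite !gt_eqF ?weight_gt0 ?eigval_gt0.
Qed.

(** At the odd index n + 1 the large diagonal entry s_n meets the matrix entry of D
    next to the diagonal: s_n / w_n * w_n w_(n+1) / (s_n + s_(n+1)) = 2 w_n / 17. *)
Lemma commutator_test n : ~~ odd n ->
  exists2 e : R, e <= 1 & D (S (test_vector n)) n.+1 = (e - 2 * weight n / 17)%:C.
Proof.
move=> en; have [Dt ->] := diag_two_basis n (weight n)^-1.
exists (entry n.+1 0).
  rewrite /entry addn0 /= en weight0 eigval0 mulr1.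
  rewrite ler_pdivrMr ?addr_gt0 ?eigval_gt0 // mul1r.
  rewrite ler_wpDr //; apply: lerXn2r; rewrite ?nnegrE ?ler_nat //.
rewrite mx_opE inner_two_basis !mx_rowE !conjc_real -rmorphM -rmorphB.
congr (_ - _)%:C; rewrite /entry oddD /= addNb addbb /= /weight /eigval !exprS.
have : 0 < (2 ^+ n : R) by rewrite exprn_gt0.
have : 0 < (16 ^+ n : R) by rewrite exprn_gt0.
move: (16 ^+ n) (2 ^+ n) => s w s0 w0; field.
by rewrite !gt_eqF // addr_gt0 // mulr_gt0.
Qed.

Lemma commutator_unbounded : ~ bounded_op (sub_op (comp_op A B) (comp_op B A)).
Proof.
move=> [M M0 bM].
(* 4 (2 w_n / 17 - 1) > 2 M as soon as w_n > 17 (M + 2). *)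
pose K := (17 * (M + 2)).
pose n := (Num.bound K).*2.
have en : ~~ odd n by rewrite odd_double.
have Kn : K < weight n.
  apply: lt_le_trans (archi_boundP _) _; first by rewrite mulr_ge0 ?addr_ge0.
  have bn : (Num.bound K <= n)%N by rewrite /n -addnn leq_addr.
  by rewrite /weight -natrX ler_nat (leq_trans bn) // ltnW // ltn_expl.
have [Dt DSt DDt] := test_domain en.
have [dt tE] := commutator Dt DSt DDt.
have [e e1 te] := commutator_test en.
have := bM _ dt; rewrite tE => /le_trans/(_ (ler_wpM2l _ (norm_test_vector n))).
rewrite ler0c => /(_ M0).
rewrite (_ : M%:C * 2 = (M * 2)%:C); last by rewrite rmorphM rmorph_nat.
move=> /(sqmod_coord_le n.+1); rewrite mulr_ge0 // => /(_ isT).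
rewrite coordZ te (_ : 4 * _ = (4 * (e - 2 * weight n / 17))%:C); last first.
  by rewrite rmorphM rmorph_nat.
rewrite sqmod_real; move: (weight n) Kn => w; rewrite /K => Kw.
rewrite -sqrrN -mulrN opprB ler_sqr ?nnegrE; [lra| |lra].
by rewrite mulr_ge0 //; lra.
Qed.

Lemma twist_counterexample :
  let T := left_twist A (J : H -> H) in
  [/\ is_operator T, densely_defined T, closed_op T,
      bounded_op (sub_op (comp_op T (adjoint T)) (comp_op (adjoint T) T)) &
      exists absT absTstar : partialMap H,
        [/\ is_modulus T absT, is_adjoint_modulus T absTstar &
            ~ bounded_op (sub_op (comp_op absT absTstar)
                                 (comp_op absTstar absT))]].
Proof.
move=> T; have saA := perturbed_self_adjoint; have pA := perturbed_positive.
have Jl := @sign_flip_linear R; have Js := @sign_flip_symmetric R.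
have JK := @sign_flipK R.
have TA := left_twist_modulus saA pA Js JK.
have TB := left_twist_adjoint_modulus saA pA Jl Js JK.
split.
- exact: left_twist_operator saA Jl.
- exact: left_twist_dense.
- exact: left_twist_closed saA Js JK.
- exists 0 => // x [Dx' Dx]; rewrite mul0r normr_le0 subr_eq0; apply/eqP.
  case: TA TB => [_ _ [dA eA]] [_ _ [dB eB]].
  rewrite -dA in Dx; rewrite -dB in Dx'.
  exact: etrans (esym (eB _ Dx')) (etrans (square_difference Dx Dx') (eA _ Dx)).
by exists A, B; split=> //; exact: commutator_unbounded.
Qed.

End Counterexample.

Theorem proposition2p8 (R : realType) :
  exists (H : hilbertSpace R) (T : partialMap H),
    [/\ is_operator T, densely_defined T, closed_op T,
        bounded_op (sub_op (comp_op T (adjoint T)) (comp_op (adjoint T) T)) &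
        exists absT absTstar : partialMap H,
          [/\ is_modulus T absT, is_adjoint_modulus T absTstar &
              ~ bounded_op (sub_op (comp_op absT absTstar)
                                   (comp_op absTstar absT))]].
Proof. by exists (ell2_hilbert R); eexists; exact: twist_counterexample. Qed.
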